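(* Let $N\ge1$, $D>0$, $\beta>0$. For any convex $(\beta,0)$-Hölder smooth $f$ with minimizer $x_\star$ satisfying $\|x_0-x_\star\|\le D$, the method $\mathtt{SSEP}$ defined by, for $n=1,\dots,N$, $$y_n=\tfrac{n}{n+1}x_{n-1}+\tfrac1{n+1}x_0,\qquad d_n=\tfrac{1}{n+1}\sum_{j=0}^{n-1}g_j,\qquad x_n=y_n-\frac{\sqrt2\,D\sqrt{N+1}}{\beta N}\,d_n,$$ where $g_j\in\partial f(x_j)$ is the subgradient returned by the oracle at $x_j$, has its terminal iterate guaranteed to satisfy $$f(x_N)-f(x_\star)\le\frac{\beta D}{\sqrt{2(N+1)}}.$$ Moreover this method is minimax optimal: it attains the minimum in $$\min_{\mathtt{a}\in\mathtt{A}_{\mathrm{span}}}\ \max_{(f,x_0)\in\mathtt{P}_{L(\cdot),D}} f(x_N)-f(x_\star),\qquad L(\delta)=\frac{\beta^2}{2\delta}.$$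
   Context: Norms are Euclidean. A convex $f$ on $\mathbb{R}^d$ is $(\beta,0)$-Hölder smooth if $\|g_x-g_y\|\le\beta$ for all $x,y\in\mathbb{R}^d$, $g_x\in\partial f(x)$, $g_y\in\partial f(y)$. A convex $f$ is $L(\cdot)$-inexactly smooth if $f(y)\le f(x)+\langle g_x,y-x\rangle+\frac{L(\delta)}2\|y-x\|^2+\delta$ for all $x,y\in\mathbb{R}^d$, $g_x\in\partial f(x)$, $\delta\ge0$, with $1/0=\infty$ (no condition at $\delta=0$ for this $L$). $\mathtt{P}_{L(\cdot),D}$ is the class of problem instances $(f,x_0)$, over every dimension $d$, where $f:\mathbb{R}^d\to\mathbb{R}$ is convex, $L(\cdot)$-inexactly smooth, attains a minimizer $x_\star$ with $\|x_0-x_\star\|\le D$, and is equipped with a subgradient oracle $g$ with $g(x)\in\partial f(x)$ for every $x$. $\mathtt{A}_{\mathrm{span}}$ is the class of $N$-step methods which, started from $x_0$, construct points $x_1,\dots,x_N$ satisfying $x_n\in x_0+\mathrm{span}\{g_0,\dots,g_{n-1}\}$ with $g_i=g(x_i)$. *)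

(* Defs.v *)
From HB Require Import structures.
From mathcomp Require Import all_boot all_order all_algebra.
From mathcomp Require Import boolp classical_sets constructive_ereal reals ereal.
From mathcomp Require Import convex.

Set Implicit Arguments.
Unset Strict Implicit.
Unset Printing Implicit Defensive.

Import Order.TTheory GRing.Theory Num.Theory.
Local Open Scope ring_scope.

Section Convex.
Variables (R : realType) (d : nat).
Implicit Types (f : 'rV[R]_d -> R) (x y u v : 'rV[R]_d).

Definition inner u v : R := \sum_(i < d) u ord0 i * v ord0 i.

(* The library norm `|_| on 'rV_d is the sup norm, hence this definition. *)
Definition enorm u : R := Num.sqrt (inner u u).

Definition convex_fun f : Prop :=
  convex_function (setT : set (convex_lmodType 'rV[R]_d)) f.

Definition is_subgradient f x g : Prop :=
  forall y, f x + inner g (y - x) <= f y.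

Definition subgradient_oracle f (g : 'rV[R]_d -> 'rV[R]_d) : Prop :=
  forall x, is_subgradient f x (g x).

Definition is_minimizer f x : Prop := forall y, f x <= f y.

(* (beta, 0)-Hölder smoothness *)
Definition holder0_smooth (beta : R) f : Prop :=
  forall x y gx gy, is_subgradient f x gx -> is_subgradient f y gy ->
    enorm (gx - gy) <= beta.

(* Where L delta = +oo the inequality holds trivially, also for y = x since
   +oo * 0 = 0 in \bar R. *)
Definition inexactly_smooth (L : R -> \bar R) f : Prop :=
  forall x y gx (delta : R), is_subgradient f x gx -> 0 <= delta ->
    ((f y)%:E <= (f x + inner gx (y - x))%:E
                 + L delta / 2%:E * (enorm (y - x) ^+ 2)%:E + delta%:E)%E.

End Convex.

Record problem (R : realType) := Problem {
  pdim : nat;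
  pobj : 'rV[R]_pdim -> R;
  pgrad : 'rV[R]_pdim -> 'rV[R]_pdim;
  pstart : 'rV[R]_pdim }.

Section Minimax.
Variables (R : realType).
Implicit Types (p : problem R) (L : R -> \bar R) (D : R) (N : nat).

Definition problem_class L D p : Prop :=
  [/\ convex_fun (@pobj R p), inexactly_smooth L (@pobj R p),
      (exists xs, is_minimizer (@pobj R p) xs
                  /\ enorm (pstart p - xs) <= D)
    & subgradient_oracle (@pobj R p) (@pgrad R p)].

(* The points x_0, x_1, ... constructed on each problem; only x_0, ..., x_N
   matter for an N-step method. How x_n is found is not restricted, so that
   exact minimization over x_0 + span{g_0, ..., g_(n-1)}, for instance, is
   a method. *)
Definition method := forall p, nat -> 'rV[R]_(pdim p).

Definition span_method N (a : method) : Prop :=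
  forall p, convex_fun (@pobj R p) ->
    subgradient_oracle (@pobj R p) (@pgrad R p) ->
    a p 0%N = pstart p /\
    forall n, (1 <= n <= N)%N ->
      a p n - pstart p \in <<[seq pgrad (a p j) | j <- iota 0 n]>>%VS.

Definition gaps N L D (a : method) : set (\bar R) :=
  [set v | exists p xs, [/\ problem_class L D p, is_minimizer (@pobj R p) xs
                          & v = (pobj (a p N) - pobj xs)%:E]]%classic.

Definition worst_case N L D (a : method) : \bar R := ereal_sup (gaps N L D a).

Definition minimax_optimal N L D (a : method) : Prop :=
  [/\ span_method N a, gaps N L D a (worst_case N L D a)
    & forall b, span_method N b ->
        (worst_case N L D a <= worst_case N L D b)%E].

End Minimax.

Section SSEP.
Variables (R : realType) (N : nat) (D beta : R).

Definition ssep_step : R := Num.sqrt 2 * D * Num.sqrt N.+1%:R / (beta * N%:R).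

Section Iterates.
Variables (d : nat) (g : 'rV[R]_d -> 'rV[R]_d) (x0 : 'rV[R]_d).

(* The pair of x_n and g_0 + ... + g_(n-1). *)
Fixpoint ssep_state (n : nat) : 'rV[R]_d * 'rV[R]_d :=
  if n is m.+1 then
    let: (x, s) := ssep_state m in
    let s' := s + g x in
    let y := (m.+1%:R / m.+2%:R) *: x + m.+2%:R^-1 *: x0 in
    (y - ssep_step *: (m.+2%:R^-1 *: s'), s')
  else (x0, 0).

Definition ssep n : 'rV[R]_d := (ssep_state n).1.

Lemma ssep0 : ssep 0 = x0.
Proof. by []. Qed.

Lemma ssepE n : (0 < n)%N ->
  let y := (n%:R / n.+1%:R) *: ssep n.-1 + n.+1%:R^-1 *: x0 in
  let dn := n.+1%:R^-1 *: \sum_(j < n) g (ssep j) in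
  ssep n = y - ssep_step *: dn.
Proof.
have E m : (ssep_state m).2 = \sum_(j < m) g (ssep j).
  elim: m => [|m IHm]; first by rewrite big_ord0.
  rewrite big_ord_recr /= -IHm /ssep.
  by case: (ssep_state m).
case: n => //= n _; rewrite big_ord_recr /= -E /ssep /=.
by case: (ssep_state n).
Qed.

End Iterates.

Definition ssep_method : method R := fun p => ssep (@pgrad R p) (pstart p).

End SSEP.

(* Main.v *)
Require Import Defs.
From mathcomp Require Import all_boot all_order all_algebra.
From mathcomp Require Import constructive_ereal reals.
From mathcomp Require Import unstable ereal convex.
From mathcomp Require Import ring lra.

Import Order.TTheory GRing.Theory Num.Theory.
Local Open Scope ring_scope.

(* Upper bound. The points z_n = (n+1) x_n - n x_(n-1) satisfy
   z_n = x_0 - h (g_0 + ... + g_(n-1)), h being the step size, and the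
   subgradient inequalities at x_n telescope to
     (N+1) (f(x_N) - f(xs)) <= sum_n <g_n, z_n - xs>
       = <S, x_0 - xs> - h/2 (|S|^2 - sum_n |g_n|^2),   S = g_0 + ... + g_N.
   Summing |g_i - g_j|^2 <= beta^2 over all pairs bounds sum_n |g_n|^2 by
   |S|^2/(N+1) + N beta^2/2; what remains is a concave quadratic in S, which
   Young's inequality bounds, and h makes the resulting bound minimal.

   For L(delta) = beta^2/(2 delta), inexact smoothness implies
   |g_x - g_y| <= beta: compare the upper bound from x with the lower bound
   from y at x + t (g_y - g_x) and let t tend to +oo.

   Lower bound. On R^(N+1) take f(x) = c max(-r, x_0, ..., x_N) with
   c = beta/sqrt 2, r = D/sqrt(N+1), started at 0. Its subgradients lie in the
   convex hull of 0 and the c e_i, of diameter beta. With an oracle answering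
   0 or some c e_i, a span method leaves a coordinate of x_N at 0, so
   f(x_N) >= 0, whereas min f = -c r. *)

(** * Euclidean inner product: bilinearity, Young's inequality, pairwise distances *)

Section Inner.
Variables (R : realType) (d : nat).
Implicit Types u v w : 'rV[R]_d.

Lemma innerC u v : inner u v = inner v u.
Proof. by apply: eq_bigr => i _; rewrite mulrC. Qed.

Lemma innerDl u v w : inner (u + v) w = inner u w + inner v w.
Proof. by rewrite -big_split; apply: eq_bigr => i _; rewrite mxE mulrDl. Qed.

Lemma innerZl (a : R) u v : inner (a *: u) v = a * inner u v.
Proof. by rewrite mulr_sumr; apply: eq_bigr => i _; rewrite mxE mulrA. Qed.

Lemma innerNl u v : inner (- u) v = - inner u v.
Proof. by rewrite -scaleN1r innerZl mulN1r. Qed.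

Lemma innerDr u v w : inner w (u + v) = inner w u + inner w v.
Proof. by rewrite innerC innerDl !(innerC w). Qed.

Lemma innerZr (a : R) u v : inner u (a *: v) = a * inner u v.
Proof. by rewrite innerC innerZl innerC. Qed.

Lemma innerNr u v : inner u (- v) = - inner u v.
Proof. by rewrite innerC innerNl innerC. Qed.

Lemma inner0l u : inner 0 u = 0.
Proof. by rewrite -(scale0r (0 : 'rV_d)) innerZl mul0r. Qed.

Lemma inner_suml (I : Type) (r : seq I) (F : I -> 'rV[R]_d) v :
  inner (\sum_(i <- r) F i) v = \sum_(i <- r) inner (F i) v.
Proof. by elim/big_ind2: _ => [|? ? ? ? <- <-|//]; rewrite ?inner0l ?innerDl. Qed.

Lemma inner_sumr (I : Type) (r : seq I) (F : I -> 'rV[R]_d) v :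
  inner v (\sum_(i <- r) F i) = \sum_(i <- r) inner v (F i).
Proof. by rewrite innerC inner_suml; apply: eq_bigr => i _; rewrite innerC. Qed.

Definition inner_lin := (innerDl, innerDr, innerZl, innerZr, innerNl, innerNr).

Lemma inner_ge0 u : 0 <= inner u u.
Proof. by apply: sumr_ge0 => i _; rewrite -expr2 sqr_ge0. Qed.

Lemma inner_gt0 u : u != 0 -> 0 < inner u u.
Proof.
rewrite lt0r inner_ge0 andbT; apply: contra => /eqP /psumr_eq0P H.
apply/eqP/rowP => i; rewrite mxE; apply/eqP; rewrite -sqrf_eq0 expr2.
by rewrite H // => j _; rewrite -expr2 sqr_ge0.
Qed.

Lemma enorm_sqr u : enorm u ^+ 2 = inner u u.
Proof. by rewrite sqr_sqrtr // inner_ge0. Qed.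

Lemma enorm_leP u (b : R) : 0 <= b -> (enorm u <= b) = (inner u u <= b ^+ 2).
Proof. by move=> b0; rewrite -enorm_sqr ler_pXn2r // nnegrE sqrtr_ge0. Qed.

Lemma inner_young (a : R) u v : 0 < a ->
  inner u v <= a / 2 * inner u u + inner v v / (2 * a).
Proof.
move=> a0; have := inner_ge0 (a *: u - v).
rewrite !inner_lin (innerC v u) => h.
have -> : inner u v = (2 * a * inner u v) / (2 * a) by field; lra.
have -> : a / 2 * inner u u + inner v v / (2 * a) =
  (a ^+ 2 * inner u u + inner v v) / (2 * a) by field; lra.
by rewrite ler_pM2r ?invr_gt0; lra.
Qed.

(** The squared distances over all ordered pairs sum to twice (m+1) sum |v_i|^2 - |sum v_i|^2. The
    diagonal contributes nothing, so only m(m+1) pairs cost b^2. *)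
Lemma sum_sqr_le (b : R) (m : nat) (v : nat -> 'rV[R]_d) :
  (forall i j, inner (v i - v j) (v i - v j) <= b ^+ 2) ->
  m.+1%:R * \sum_(i < m.+1) inner (v i) (v i) <=
    inner (\sum_(i < m.+1) v i) (\sum_(i < m.+1) v i)
    + m.+1%:R * m%:R * b ^+ 2 / 2.
Proof.
move=> vb; pose q := \sum_(i < m.+1) inner (v i) (v i).
pose s := \sum_(i < m.+1) v i.
have E : \sum_(i < m.+1) \sum_(j < m.+1) inner (v i - v j) (v i - v j) =
  2 * (m.+1%:R * q - inner s s).
  transitivity (\sum_(i < m.+1) (m.+1%:R * inner (v i) (v i) + q
                                 - 2 * inner (v i) s)).
    apply: eq_bigr => i _.
    have -> : m.+1%:R * inner (v i) (v i) = \sum_(j < m.+1) inner (v i) (v i).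
      by rewrite sumr_const card_ord mulr_natl.
    rewrite inner_sumr [2 * _]mulr_sumr /q -big_split -sumrB.
    apply: eq_bigr => j _ /=.
    by rewrite !inner_lin (innerC (v j)); ring.
  rewrite sumrB big_split /= -!mulr_sumr -inner_suml sumr_const card_ord.
  by rewrite -/s -/q -mulr_natl; ring.
have : \sum_(i < m.+1) \sum_(j < m.+1) inner (v i - v j) (v i - v j) <=
       m.+1%:R * (m%:R * b ^+ 2).
  have -> : m.+1%:R * (m%:R * b ^+ 2) = \sum_(i < m.+1) (m%:R * b ^+ 2).
    by rewrite sumr_const card_ord -[RHS]mulr_natl.
  rewrite ler_sum // => i _.
  rewrite (bigD1 i) //= subrr inner0l add0r.
  apply: (@le_trans _ _ (\sum_(j < m.+1 | j != i) b ^+ 2)).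
    by apply: ler_sum => j _; apply: vb.
  by rewrite sumr_const cardC1 card_ord mulr_natl.
rewrite E -/q -/s; lra.
Qed.

End Inner.

(** * Consequences of subgradient inequalities and of inexact smoothness *)

Section Smoothness.
Variables (R : realType) (d : nat).
Implicit Types (f : 'rV[R]_d -> R) (g : 'rV[R]_d -> 'rV[R]_d).

(** Average the subgradient inequalities at the convex combination z towards x and y: the linear
    terms cancel. This supplies the convexity of the hard function. *)
Lemma subgradient_oracle_convex f g : subgradient_oracle f g -> convex_fun f.
Proof.
move=> fg t x y _ _; rewrite convRE.
set z := conv t x y.
have Hx := fg z x; have Hy := fg z y.
have t0 : 0 <= t%:num by [].
have t1 : 0 <= 1 - t%:num by rewrite subr_ge0.
have E : t%:num * inner (g z) (x - z) + (1 - t%:num) * inner (g z) (y - z) = 0.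
  rewrite -!innerZr -innerDr.
  suff -> : t%:num *: (x - z) + (1 - t%:num) *: (y - z) = 0 :> 'rV_d.
    by rewrite innerC inner0l.
  have -> : z = t%:num *: (x : 'rV_d) + (1 - t%:num) *: (y : 'rV_d) by [].
  by apply/rowP => i; rewrite !mxE; ring.
rewrite /onem; have := ler_wpM2l t0 Hx; have := ler_wpM2l t1 Hy; lra.
Qed.

(** For positive delta every factor is finite, so the inequality descends from the extended reals to
    [R]. *)
Lemma inexact_boundE (beta delta a b q : R) : 0 < delta ->
  (b%:E <= a%:E + (beta ^+ 2)%:E / (2 * delta)%:E / 2%:E * q%:E + delta%:E)%E =
  (b <= a + beta ^+ 2 * q / (4 * delta) + delta).
Proof.
move=> d0; rewrite !inver pnatr_eq0 gt_eqF ?mulr_gt0 // -!EFinM -!EFinD lee_fin.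
by congr (_ <= _ + _ + _); field; rewrite gt_eqF.
Qed.

Lemma inexactly_smooth_holder0 (beta : R) f : 0 < beta ->
  inexactly_smooth (fun delta => ((beta ^+ 2)%:E / (2 * delta)%:E)%E) f ->
  holder0_smooth beta f.
Proof.
move=> b0 fL x y gx gy fx fy; rewrite enorm_leP; last exact: ltW.
move Eu: (gx - gy) => u; set q := inner u u.
rewrite leNgt; apply/negP => bq.
have q0 : 0 < q by apply: lt_trans bq; rewrite exprn_gt0.
pose C := f x - f y - inner gy (x - y).
have key (t : R) : 0 < t -> t * (q - beta ^+ 2) <= 2 * C.
  (* With delta = t q / 2 both error terms are linear in t: they are beta^2 t / 2 and t q / 2,
     against the gain t q from the linear terms. *)
  move=> t0; have d0 : 0 < t * q / 2 by rewrite divr_gt0 // mulr_gt0.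
  have := fL x (x - t *: u) gx _ fx (ltW d0).
  rewrite inexact_boundE // enorm_sqr.
  have := fy (x - t *: u).
  have -> : x - t *: u - x = - (t *: u) by rewrite addrC addKr.
  have -> : x - t *: u - y = x - y - t *: u by rewrite addrAC.
  rewrite !(innerDr _ _ _ (- _)) !innerNr innerNl !innerZr innerZl -/q.
  have -> : beta ^+ 2 * - - (t * (t * q)) / (4 * (t * q / 2)) = beta ^+ 2 * t / 2.
    by field; rewrite !gt_eqF.
  have : t * (inner gx u - inner gy u) = t * q by rewrite -innerNl -innerDl Eu.
  by rewrite /C innerDr innerNr; lra.
have C0 : 0 <= C by have := fy x; rewrite /C; lra.
(* At this t, [key] would read 2 C + 1 <= 2 C. *)
have := key ((2 * C + 1) / (q - beta ^+ 2)).
rewrite divr_gt0 ?subr_gt0 //; last by lra.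
by rewrite divfK ?subr_eq0 ?gt_eqF // => /(_ isT); lra.
Qed.
End Smoothness.

(** * Guarantee for the terminal iterate of [ssep] *)

Section UpperBound.
Variables (R : realType) (N : nat) (D beta : R) (d : nat).
Variables (f : 'rV[R]_d -> R) (g : 'rV[R]_d -> 'rV[R]_d) (x0 xs : 'rV[R]_d).

Let x := ssep N D beta g x0.
Let h := ssep_step N D beta.
Let S n := \sum_(j < n) g (x j).

(** This is z_(n+1) = x_0 - h (g_0 + ... + g_n) with z_(n+1) expanded. *)
Lemma ssepS_scaled n :
  n.+2%:R *: x n.+1 = n.+1%:R *: x n + x0 - h *: S n.+1.
Proof.
rewrite {1}/x ssepE // -/x -/h /S; apply/rowP => i; rewrite !mxE.
by field; rewrite -natrD pnatr_eq0.
Qed.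

(* The subgradient inequalities at x_n towards xs (weight 1) and towards
   x_(n-1) (weight n) add up to a bound by <g_n, z_n - xs>. *)
Lemma ssep_telescope n : subgradient_oracle f g ->
  n.+1%:R * (f (x n) - f xs) <= inner (S n.+1) (x0 - xs)
    - h / 2 * (inner (S n.+1) (S n.+1)
               - \sum_(j < n.+1) inner (g (x j)) (g (x j))).
Proof.
move=> fg; pose Q m := \sum_(j < m) inner (g (x j)) (g (x j)).
have SS m : S m.+1 = S m + g (x m) by rewrite /S big_ord_recr.
have QS m : Q m.+1 = Q m + inner (g (x m)) (g (x m)) by rewrite /Q big_ord_recr.
rewrite -/(Q n.+1); elim: n => [|n IH].
  rewrite /S /Q !big_ord1 subrr mulr0 subr0 mul1r.
  have := fg (x 0) xs; rewrite {2 4}/x ssep0.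
  by rewrite -(opprB x0 xs) innerNr /x ssep0; lra.
rewrite SS QS.
move: IH (ssepS_scaled n) (fg (x n.+1) xs) (fg (x n.+1) (x n)).
set s := S n.+1; set u := g (x n.+1); set q := Q n.+1.
move=> IH E H1 H2.
(* Pairing with u produces the cross term -h <s, u>, which is the increment of the quadratic part
   because |s + u|^2 - |s|^2 - |u|^2 = 2 <s, u>. *)
have : inner u (n.+2%:R *: x n.+1) = inner u (n.+1%:R *: x n + x0 - h *: s).
  by rewrite E.
move: IH H1 H2; rewrite !inner_lin (innerC _ _ s u) -(natr1 n.+1) -(natr1 n).
have : 0 <= n%:R + 1 :> R by rewrite natr1 ler0n.
move=> n0 IH H1 /(ler_wpM2l n0) H2 E'; lra.
Qed.

Lemma ssep_gap_le : (0 < N)%N -> 0 < D -> 0 < beta ->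
  subgradient_oracle f g -> holder0_smooth beta f -> enorm (x0 - xs) <= D ->
  f (x N) - f xs <= beta * D / Num.sqrt (2 * N.+1%:R).
Proof.
move=> N0 D0 b0 fg fb x0D.
have n0 : 0 < N%:R :> R by rewrite ltr0n.
have n1 : 0 < N.+1%:R :> R by rewrite ltr0n.
have gb i j : inner (g (x i) - g (x j)) (g (x i) - g (x j)) <= beta ^+ 2.
  by rewrite -enorm_leP ?(ltW b0) //; apply: fb.
have := ssep_telescope N fg.
have := sum_sqr_le _ _ _ N (fun i => g (x i)) gb; rewrite -/(S N.+1).
set Q := \sum_(j < _) _; set s := S _.
have w2 : inner (x0 - xs) (x0 - xs) <= D ^+ 2 by rewrite -enorm_leP // ltW.
have r0 : 0 < Num.sqrt N.+1%:R :> R by rewrite sqrtr_gt0.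
have t0 : 0 < Num.sqrt 2 :> R by rewrite sqrtr_gt0.
have h0 : 0 < h by apply: divr_gt0; do !apply: mulr_gt0.
(* Young's inequality with this weight yields a/2 |S|^2 = h/2 (|S|^2 - |S|^2/(N+1)), which cancels
   all that remains of |S|^2. *)
pose a := h * N%:R / N.+1%:R.
have a0 : 0 < a by apply: divr_gt0 => //; apply: mulr_gt0.
move=> Qs T; have Y := inner_young _ _ _ s (x0 - xs) a0.
have Qs' : Q <= inner s s / N.+1%:R + N%:R * beta ^+ 2 / 2.
  rewrite -(ler_pM2l n1); apply: le_trans Qs _.
  rewrite le_eqVlt; apply/orP; left; apply/eqP.
  by field; rewrite gt_eqF.
have W : inner (x0 - xs) (x0 - xs) / (2 * a) <= D ^+ 2 / (2 * a).
  by rewrite ler_pM2r // invr_gt0 mulr_gt0.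
have : N.+1%:R * (f (x N) - f xs) <=
    D ^+ 2 / (2 * a) + h / 2 * (N%:R * beta ^+ 2 / 2).
  have h2 : 0 <= h / 2 by rewrite divr_ge0 // ltW.
  have := ler_wpM2l h2 Qs'.
  have : a / 2 * inner s s = h / 2 * inner s s - h / 2 * (inner s s / N.+1%:R).
    by rewrite /a -natr1; field; rewrite natr1 gt_eqF.
  rewrite mulrDr => E H; move: Y W T; rewrite E [h / 2 * (_ - _)]mulrBr; move: E H.
  move: (h / 2 * (_ / _)) (h / 2 * Q) (h / 2 * inner s s) (_ / (2 * a)).
  by move=> p1 p2 p3 p4; move: (D ^+ 2 / _) => *; lra.
(* The value of h makes the two terms of [K] equal; their sum is exactly N+1 times the claimed
   bound. *)
move=> K; rewrite -(ler_pM2l n1); apply: le_trans K _.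
rewrite le_eqVlt; apply/orP; left; apply/eqP.
rewrite sqrtrM //; rewrite /a /h /ssep_step.
have En : N.+1%:R = Num.sqrt N.+1%:R ^+ 2 :> R by rewrite sqr_sqrtr.
have E2 : 2 = Num.sqrt 2 ^+ 2 :> R by rewrite sqr_sqrtr.
move: En E2 r0 t0; set r := Num.sqrt N.+1%:R; set t := Num.sqrt 2.
move=> -> E2 r0 t0; apply/eqP; rewrite -subr_eq0.
(* With t an opaque symbol for sqrt 2, the difference of the two sides is exhibited as a multiple of
   t^2 - 2. *)
suff -> : D ^+ 2 / (2 * (t * D * r / (beta * N%:R) * N%:R / r ^+ 2))
    + t * D * r / (beta * N%:R) / 2 * (N%:R * beta ^+ 2 / 2)
    - r ^+ 2 * (beta * D / (t * r)) = D * beta * r / (4 * t) * (t ^+ 2 - 2).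
  by rewrite -E2 subrr mulr0.
by field; rewrite !gt_eqF.
Qed.
End UpperBound.

(** * The hard piecewise linear function and its resisting oracle *)

Section LowerBound.
Variables (R : realType) (n : nat) (c r : R).
Hypothesis c0 : 0 < c.
Implicit Types x y gx : 'rV[R]_n.

(** The default value [- r] of the iterated maximum competes with the coordinates and bounds the
    function below. *)
Definition hard_obj (x : 'rV[R]_n) : R :=
  c * \big[Num.max/- r]_(i < n) x ord0 i.

(** Answering with one active piece, never a mixture, reveals at most one coordinate per call. *)
Definition hard_grad (x : 'rV[R]_n) : 'rV[R]_n :=
  if [pick i | hard_obj x == c * x ord0 i] is Some i
  then c *: delta_mx ord0 i else 0.

Lemma hard_obj_ge_floor x : - (c * r) <= hard_obj x.
Proof. by rewrite -mulrN ler_pM2l // bigmax_ge_id. Qed.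

Lemma hard_obj_ge x i : c * x ord0 i <= hard_obj x.
Proof. by rewrite ler_pM2l // le_bigmax. Qed.

Lemma hard_obj_leP x a :
  reflect (- (c * r) <= a /\ forall i, c * x ord0 i <= a) (hard_obj x <= a).
Proof.
have E (b : R) : (c * b <= a) = (b <= a / c) by rewrite ler_pdivlMr // mulrC.
rewrite /hard_obj -mulrN !E; apply: (iffP (bigmax_leP _ _ _ _)) => -[H1 H2].
  by split=> // i; rewrite E; apply: H2.
by split=> // i _; rewrite -E.
Qed.

Lemma hard_objE x : hard_obj x = - (c * r) \/ exists i, hard_obj x = c * x ord0 i.
Proof.
have : \big[Num.max/- r]_(i < n) x ord0 i = - r \/
    exists i, \big[Num.max/- r]_(i < n) x ord0 i = x ord0 i.
  elim/big_ind: _ => [|a b Ha Hb|i _]; [by left| |by right; exists i].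
  by case: (leP a b).
by case=> [H|[i H]]; [left|right; exists i]; rewrite /hard_obj H ?mulrN.
Qed.

Lemma inner_delta (x : 'rV[R]_n) i : inner (delta_mx ord0 i) x = x ord0 i.
Proof.
rewrite /inner (bigD1 i) //= big1 ?addr0 => [|j /negPf ji].
  by rewrite mxE !eqxx mul1r.
by rewrite mxE ji andbF mul0r.
Qed.

Lemma hard_grad_oracle : subgradient_oracle hard_obj hard_grad.
Proof.
move=> x y; rewrite /hard_grad; case: pickP => [i /eqP E|none].
  rewrite innerZl inner_delta E !mxE mulrBr addrC subrK.
  exact: hard_obj_ge.
case: (hard_objE x) => [E|[i E]]; last by have := none i; rewrite E eqxx.
by rewrite inner0l addr0 E hard_obj_ge_floor.
Qed.

(** Test the subgradient inequality at x - e_i, where the function does not increase, and at x + (1,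
    ..., 1), where it grows by at most c. *)
Lemma hard_subgradient_bounds x gx : is_subgradient hard_obj x gx ->
  (forall i, 0 <= gx ord0 i) /\ \sum_i gx ord0 i <= c.
Proof.
move=> H; split=> [i|].
  have := H (x - delta_mx ord0 i); rewrite addrAC subrr add0r innerNr.
  rewrite innerC inner_delta => H1.
  suff : hard_obj (x - delta_mx ord0 i) <= hard_obj x by lra.
  apply/hard_obj_leP; split=> [|j]; first exact: hard_obj_ge_floor.
  apply: le_trans (hard_obj_ge x j); rewrite ler_pM2l // !mxE.
  by rewrite gerBl ler0n.
have := H (x + const_mx 1); rewrite addrAC subrr add0r.
have -> : inner gx (const_mx 1) = \sum_i gx ord0 i.
  by apply: eq_bigr => i _; rewrite mxE mulr1.
suff : hard_obj (x + const_mx 1) <= hard_obj x + c by lra.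
apply/hard_obj_leP; split=> [|j].
  by have := hard_obj_ge_floor x; move: c0; lra.
by have := hard_obj_ge x j; rewrite !mxE; lra.
Qed.

(** Each entry lies between 0 and c, so sum g_i^2 <= c sum g_i <= c^2. *)
Lemma hard_subgradient_sqr_le x gx : is_subgradient hard_obj x gx ->
  inner gx gx <= c ^+ 2.
Proof.
case/hard_subgradient_bounds => g0 gs.
apply: (@le_trans _ _ ((\sum_i gx ord0 i) * c)); last first.
  by rewrite expr2 ler_pM2r.
rewrite mulr_suml; apply: ler_sum => i _; rewrite ler_wpM2l //.
apply: le_trans gs; rewrite (bigD1 i) //= lerDl.
by apply: sumr_ge0.
Qed.

(** Take the affine piece <v, .> + b active at y. It lies below the function at x, so the
    linearization error is at most <v - gx, y - x>, to which Young's inequality applies with |v -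
    gx| <= beta. *)
Lemma hard_inexactly_smooth (beta : R) : beta ^+ 2 = 2 * c ^+ 2 ->
  inexactly_smooth (fun delta => ((beta ^+ 2)%:E / (2 * delta)%:E)%E) hard_obj.
Proof.
move=> bc x y gx delta gxP.
have b2 : 0 < beta ^+ 2 by rewrite bc mulr_gt0 // exprn_gt0.
rewrite le_eqVlt => /orP[/eqP <-|d0].
  (* At delta = 0 the coefficient is +oo: the right side is +oo for y != x, and for y = x the
     product +oo * 0 is 0, leaving an equality. *)
  rewrite mulr0 inver eqxx enorm_sqr adde0.
  have [->|yx] := eqVneq y x.
    by rewrite subrr inner0l mule0 adde0 innerC inner0l addr0.
  rewrite mulry gtr0_sg // mul1e gt0_mulye ?lte_fin ?invr_gt0 //.
    by rewrite gt0_mulye ?lte_fin ?inner_gt0 ?subr_eq0 // addey // leey.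
  by rewrite inver pnatr_eq0 lte_fin invr_gt0.
rewrite inexact_boundE // enorm_sqr.
move: (beta ^+ 2) bc b2 => B bc B0.
suff [v [b [vb Hy Hx]]] : exists v b, [/\ inner (v - gx) (v - gx) <= B,
    hard_obj y = inner v y + b & inner v x + b <= hard_obj x].
  (* This Young weight turns |v - gx|^2 <= B into an error of at most delta. *)
  have d2 : 0 < 2 * delta / B by rewrite divr_gt0 // mulr_gt0.
  have := inner_young _ _ _ (v - gx) (y - x) d2.
  have -> : inner (y - x) (y - x) / (2 * (2 * delta / B)) =
      B * inner (y - x) (y - x) / (4 * delta).
    by field; rewrite !gt_eqF.
  have : 2 * delta / B / 2 * inner (v - gx) (v - gx) <= delta.
    have -> : 2 * delta / B / 2 * inner (v - gx) (v - gx) =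
        delta * (inner (v - gx) (v - gx) / B).
      by field; rewrite gt_eqF.
    apply: ler_piMr; first exact: ltW.
    by rewrite ler_pdivrMr // mul1r.
  by rewrite Hy; move: Hx; rewrite !innerDl !innerDr !innerNl !innerNr; lra.
have gx2 := hard_subgradient_sqr_le _ _ gxP.
have [g0 _] := hard_subgradient_bounds _ _ gxP.
(* On the floor v = 0 and |gx|^2 <= c^2; otherwise v = c e_i and |v - gx|^2 = c^2 - 2 c g_i + |gx|^2
   <= 2 c^2 since g_i >= 0. *)
case: (hard_objE y) => [E|[i E]].
  exists 0, (- (c * r)); rewrite !inner0l !add0r E; split=> //.
    by rewrite innerNl innerNr opprK bc; have := sqr_ge0 c; lra.
  exact: hard_obj_ge_floor.
exists (c *: delta_mx ord0 i), 0; rewrite !addr0 !innerZl !inner_delta; split=> //.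
  rewrite !inner_lin !inner_delta (innerC _ _ gx) inner_delta mxE !eqxx bc.
  by have := mulr_ge0 (ltW c0) (g0 i); rewrite /=; lra.
exact: hard_obj_ge.
Qed.

Lemma hard_minimizer : is_minimizer hard_obj (const_mx (- r)).
Proof.
move=> y; apply: le_trans (hard_obj_ge_floor y).
by apply/hard_obj_leP; split=> // i; rewrite mxE mulrN.
Qed.

Lemma hard_obj_minE : hard_obj (const_mx (- r)) = - (c * r).
Proof.
apply/eqP; rewrite eq_le hard_obj_ge_floor andbT.
by apply/hard_obj_leP; split=> // i; rewrite mxE mulrN.
Qed.

(* The gradients at the points of s involve fewer than n coordinates, so some
   coordinate of x vanishes. *)
Lemma hard_obj_ge0_span (s : seq 'rV[R]_n) x : (size s < n)%N ->
  x \in <<[seq hard_grad z | z <- s]>>%VS -> 0 <= hard_obj x.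
Proof.
move=> sn xs; pose idx z := [pick i | hard_obj z == c * z ord0 i].
have [i iP] : exists i, i \notin pmap idx s.
  apply/existsP; apply: contraLR sn; rewrite negb_exists -leqNgt => /forallP H.
  have sub : {subset enum 'I_n <= pmap idx s}.
    by move=> i _; have := H i; rewrite negbK.
  have := uniq_leq_size (enum_uniq 'I_n) sub; rewrite size_enum_ord.
  move=> /leq_trans; apply.
  by rewrite size_pmap count_size.
suff xi : x ord0 i = 0 by have := hard_obj_ge x i; rewrite xi mulr0.
have zi z : z \in s -> hard_grad z ord0 i = 0.
  move=> zs; rewrite /hard_grad -/(idx z).
  case E : (idx z) => [j|]; last by rewrite mxE.
  suff ji : j != i by rewrite !mxE eq_sym (negPf ji) andbF mulr0.
  by apply: contraNneq iP => <-; rewrite mem_pmap; apply/mapP; exists z.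
rewrite (coord_span (X := in_tuple _) xs) summxE big1 // => k _; rewrite mxE.
have /mapP[z zs ->] := mem_nth 0 (ltn_ord k : (k < size (in_tuple _))%N).
by rewrite zi ?mulr0.
Qed.

End LowerBound.

(** * Matching bounds over the problem class and optimality of [ssep_method] *)

Section Minimax.
Variables (R : realType) (N : nat) (D beta : R).
Hypotheses (N0 : (0 < N)%N) (D0 : 0 < D) (b0 : 0 < beta).

Let L (delta : R) : \bar R := ((beta ^+ 2)%:E / (2 * delta)%:E)%E.
Let bound : R := beta * D / Num.sqrt (2 * N.+1%:R).

Lemma ssep_span_method : span_method N (ssep_method N D beta).
Proof.
move=> p _ _; split=> // n _; rewrite /ssep_method.
set g := @pgrad R p; set x0 := pstart p; set x := ssep _ _ _ _ _.
elim: n => [|n IH]; first by rewrite /x ssep0 subrr mem0v.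
have sub m : (m <= n.+1)%N ->
    (<<[seq g (x j) | j <- iota 0 m]>> <= <<[seq g (x j) | j <- iota 0 n.+1]>>)%VS.
  move=> mn; apply: sub_span => v /mapP[j jm ->]; apply/mapP; exists j => //.
  by move: jm; rewrite !mem_iota /= !add0n => /leq_trans; apply.
rewrite /x ssepE // -/x /=.
(* The weights of x_n and x_0 sum to 1, so subtracting x_0 leaves a multiple of x_n - x_0. *)
have -> : n.+1%:R / n.+2%:R *: x n + n.+2%:R^-1 *: x0 -
    ssep_step N D beta *: (n.+2%:R^-1 *: \sum_(j < n.+1) g (x j)) - x0 =
    (n.+1%:R / n.+2%:R) *: (x n - x0) -
    ssep_step N D beta *: (n.+2%:R^-1 *: \sum_(j < n.+1) g (x j)).
  by apply/rowP => i; rewrite !mxE; field; rewrite -natrD pnatr_eq0.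
apply: memvB; first by apply: memvZ; apply: (subvP (sub n _)).
do 2!apply: memvZ; apply: memv_suml => j _; apply: memv_span.
rewrite -[_ :: _]/[seq g (x k) | k <- iota 0 n.+1].
by apply/mapP; exists (val j); rewrite // mem_iota /=.
Qed.

Lemma ssep_worst_gap_le v : gaps N L D (ssep_method N D beta) v -> (v <= bound%:E)%E.
Proof.
case=> p [xs [[cf Lf [xm [mm Dm]] fg] minxs ->]]; rewrite lee_fin.
(* The minimizer measuring the gap may differ from the one within distance D of the start; their
   values agree. *)
have -> : pobj xs = pobj xm by apply/eqP; rewrite eq_le minxs mm.
by apply: ssep_gap_le => //; apply: inexactly_smooth_holder0 Lf.
Qed.

(** A single instance defeats every span method: x_N depends on N gradients only, one fewer than the
    N+1 coordinates. *)
Lemma span_method_gap_ge (b : method R) : span_method N b ->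
  exists2 v, gaps N L D b v & (bound%:E <= v)%E.
Proof.
(* Here 2 c^2 = beta^2 gives the smoothness, (N+1) r^2 = D^2 puts the minimizer at distance D from
   0, and c r is the bound. *)
move=> bspan; pose c := beta / Num.sqrt 2; pose r := D / Num.sqrt N.+1%:R.
have n0 : 0 < N.+1%:R :> R by rewrite ltr0n.
have r0 : 0 < r by rewrite divr_gt0 // sqrtr_gt0.
have c0 : 0 < c by rewrite divr_gt0 // sqrtr_gt0.
pose p := @Problem R N.+1 (hard_obj R N.+1 c r) (hard_grad R N.+1 c r) 0.
have fg : subgradient_oracle (@pobj R p) (@pgrad R p) by apply: hard_grad_oracle.
have cf := subgradient_oracle_convex _ _ _ _ fg.
have minp : is_minimizer (@pobj R p) (const_mx (- r)) by apply: hard_minimizer.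
have [b00 bsp] := bspan p cf fg.
exists (pobj (b p N) - pobj (const_mx (- r) : 'rV[R]_(pdim p)))%:E.
  exists p, (const_mx (- r)); split=> //; split=> //.
    apply: hard_inexactly_smooth => //.
    by rewrite /c expr_div_n sqr_sqrtr // mulrC divfK.
  exists (const_mx (- r)); split=> //.
  rewrite enorm_leP ?(ltW D0) // /inner (eq_bigr (fun=> r ^+ 2)).
    rewrite sumr_const card_ord -mulr_natr /r expr_div_n sqr_sqrtr //.
    by rewrite divfK ?gt_eqF.
  by move=> i _; rewrite !mxE sub0r opprK expr2.
rewrite lee_fin /= hard_obj_minE // opprK.
have -> : bound = c * r.
  by rewrite /bound /c /r sqrtrM // invfM; ring.
rewrite lerDr; apply: (@hard_obj_ge0_span _ _ _ _ c0 [seq b p j | j <- iota 0 N]).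
  by rewrite size_map size_iota.
by have := bsp N; rewrite N0 leqnn subr0 -map_comp; apply.
Qed.

Lemma ssep_minimax_optimal : minimax_optimal N L D (ssep_method N D beta).
Proof.
(* Applied to [ssep_method] itself, the lower bound provides an instance attaining the supremum, so
   the worst case is a maximum. *)
have [v gv bv] := span_method_gap_ge _ ssep_span_method.
have vE : v = bound%:E by apply/eqP; rewrite eq_le bv ssep_worst_gap_le.
have W : worst_case N L D (ssep_method N D beta) = bound%:E.
  apply/eqP; rewrite eq_le; apply/andP; split.
    by apply: ge_ereal_sup => w; apply: ssep_worst_gap_le.
  by rewrite -vE; apply: ereal_sup_ubound.
split; [exact: ssep_span_method| by rewrite W -vE|].
move=> b /span_method_gap_ge [w gw bw]; rewrite W; apply: le_trans bw _.
exact: ereal_sup_ubound.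
Qed.

End Minimax.

Theorem theorem4p2 (R : realType) (N : nat) (D beta : R)
    (hN : (1 <= N)%N) (hD : 0 < D) (hbeta : 0 < beta) :
  (forall (d : nat) (f : 'rV[R]_d -> R) (g : 'rV[R]_d -> 'rV[R]_d)
          (x0 xs : 'rV[R]_d),
     convex_fun f -> holder0_smooth beta f -> subgradient_oracle f g ->
     is_minimizer f xs -> enorm (x0 - xs) <= D ->
     f (ssep N D beta g x0 N) - f xs <= beta * D / Num.sqrt (2 * N.+1%:R)) /\
  minimax_optimal N (fun delta : R => ((beta ^+ 2)%:E / (2 * delta)%:E)%E) D
    (ssep_method N D beta).
Proof.
split; last exact: ssep_minimax_optimal.
by move=> d f g x0 xs _ fb fg _ x0D; apply: ssep_gap_le.
Qed.
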